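(* Let $G$ be a simple 2-connected graph of order $n$. Then $\alpha(G)\geq \alpha(C_{n})$. Moreover, (i) if $n$ is odd and $\alpha(G)=\alpha(C_n)$, then $G \cong C_{n}$ or $G \cong H_{1}(i_{1}, \ldots, i_{k})$ for some $i_{1}, \ldots, i_{k}$; (ii) if $n$ is even and $\alpha(G)=\alpha(C_n)$, then $G \cong C_{n}$, or $G \cong H_{2}(i_{1}, \ldots, i_{k})$ for some $i_{1}, \ldots, i_{k}$, or $G \cong H_{3}(j_{1}, \ldots, j_{s})$ for some $j_{1}, \ldots, j_{s}$. Here the graphs $H_1(\cdot), H_2(\cdot), H_3(\cdot)$ have order $n$ and their indices range over the admissible values given in their definitions.
   Context: All graphs are finite, connected, undirected and simple (no loops, no multiple edges). The order of a graph is its number of vertices. Algebraic connectivity: for a graph $G$ of order $n$, the Laplacian matrix is $L(G)=D(G)-A(G)$, where $A(G)$ is the adjacency matrix and $D(G)$ is the diagonal matrix of vertex degrees. Its eigenvalues, counted with multiplicity, are $\mu_1(G)\ge \mu_2(G)\ge\cdots\ge\mu_{n-1}(G)\ge\mu_n(G)=0$, and $\alpha(G)=\mu_{n-1}(G)$ is the algebraic connectivity (the second smallest Laplacian eigenvalue). 2-connected: two paths from $u$ to $v$ are inner disjoint if their only common vertices are $u$ and $v$. For distinct vertices $u,v$, $p(u,v)$ denotes the maximum number of pairwise inner disjoint paths from $u$ to $v$. A nontrivial graph (at least two vertices) is 2-connected if $p(u,v)\ge 2$ for any two distinct vertices $u,v$ (for simple graphs this forces $n\ge 3$). $C_n=v_0v_1v_2\cdots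 v_{n-1}v_0$ is the cycle with $n$ vertices. $G+uv$ denotes the graph obtained from $G$ by adding the edge $uv$. The following graphs are simple, so a repeated index contributes only one edge. - For odd $n\ge 5$, $1\le k\le \frac{n-3}{2}$ and $1\le i_1\le\cdots\le i_k\le\frac{n-3}{2}$: $H_1(i_1,\ldots,i_k)=C_n+v_{i_1}v_{n-i_1}+\cdots+v_{i_k}v_{n-i_k}$. - For even $n\ge 4$, $1\le k\le \frac{n-2}{2}$ and $1\le i_1\le\cdots\le i_k\le\frac{n-2}{2}$: $H_2(i_1,\ldots,i_k)=C_n+v_{i_1}v_{n-i_1}+\cdots+v_{i_k}v_{n-i_k}$. - For even $n\ge 6$, $1\le k\le \frac{n-4}{2}$ and $1\le i_1\le\cdots\le i_k\le\frac{n-4}{2}$: $H_3(i_1,\ldots,i_k)=C_n+v_{i_1}v_{n-i_1-1}+\cdots+v_{i_k}v_{n-i_k-1}$. *)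

(* Defs.v *)
From mathcomp Require Import all_boot all_order all_algebra.
From mathcomp Require Import reals.
From mathcomp Require Import polyrcf.

Set Implicit Arguments.
Unset Strict Implicit.
Unset Printing Implicit Defensive.

Import Order.TTheory GRing.Theory Num.Theory.

Record sgraph (T : finType) := SGraph {
  edge :> rel T;
  edge_sym : symmetric edge;
  edge_irrefl : irreflexive edge }.

Definition isomorphic (T U : finType) (G : sgraph T) (H : sgraph U) : Prop :=
  exists2 f : T -> U, bijective f & forall x y, H (f x) (f y) = G x y.

Section TwoConnected.
Variables (T : finType) (G : sgraph T).

(* The path u, x_1, ..., x_k = v is represented by [:: x_1; ...; x_k]; its
   vertices are distinct, so the length bound #|T| excludes no path. *)
Definition is_upath (u v : T) (p : #|T|.-bseq T) : bool :=
  [&& path G u p, last u p == v & uniq (u :: p)].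

Definition inner_disjoint (u v : T) (p q : #|T|.-bseq T) : bool :=
  [forall x, (x \in u :: p) && (x \in u :: q) ==> (x == u) || (x == v)].

Definition disjoint_paths (u v : T) (P : {set #|T|.-bseq T}) : bool :=
  [forall p in P, is_upath u v p] &&
  [forall p in P, forall q in P, (p != q) ==> inner_disjoint u v p q].

Definition max_disjoint_paths (u v : T) : nat :=
  \max_(P : {set #|T|.-bseq T} | disjoint_paths u v P) #|P|.

Definition two_connected : Prop :=
  1 < #|T| /\ forall u v : T, u != v -> 2 <= max_disjoint_paths u v.

End TwoConnected.

Section Spectrum.
Local Open Scope ring_scope.

(* Real eigenvalues repeated according to their multiplicity as roots of the
   characteristic polynomial, in nonincreasing order. *)
Definition spectrum (R : realType) (n : nat) (A : 'M[R]_n) : seq R :=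
  sort >=%R
    (flatten [seq nseq (mup x (char_poly A)) x | x <- rootsR (char_poly A)]).

Variables (R : realType) (T : finType) (G : sgraph T).

Definition degree (x : T) : nat := #|[set y | G x y]|.

Definition adjacency_mx : 'M[R]_#|T| :=
  \matrix_(i, j) (G (enum_val i) (enum_val j))%:R.

Definition degree_mx : 'M[R]_#|T| :=
  diag_mx (\row_i (degree (enum_val i))%:R).

Definition laplacian : 'M[R]_#|T| := degree_mx - adjacency_mx.

(* Indices start at 0, so mu_(n-1) sits at position n - 2. *)
Definition algebraic_connectivity : R :=
  nth 0 (spectrum laplacian) (#|T| - 2)%N.

End Spectrum.

Section Cycles.
Variable n : nat.

Definition cycle_rel : rel 'I_n :=
  [rel x y : 'I_n | (x != y) &&
     ((x.+1 %% n == y :> nat) || (y.+1 %% n == x :> nat))].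

Fact cycle_rel_sym : symmetric cycle_rel.
Proof. by move=> x y; rewrite /cycle_rel /= eq_sym orbC. Qed.

Fact cycle_rel_irrefl : irreflexive cycle_rel.
Proof. by move=> x; rewrite /cycle_rel /= eqxx. Qed.

Definition cycle_graph : sgraph 'I_n :=
  SGraph cycle_rel_sym cycle_rel_irrefl.

(* G + v_a v_b, the vertices being given by their numbers. *)
Definition add_edge_rel (G : sgraph 'I_n) (a b : nat) : rel 'I_n :=
  [rel x y : 'I_n | G x y || ((x != y) &&
     ((x == a :> nat) && (y == b :> nat) ||
      (x == b :> nat) && (y == a :> nat)))].

Fact add_edge_sym G a b : symmetric (add_edge_rel G a b).
Proof.
move=> x y; rewrite /add_edge_rel /= edge_sym (eq_sym x y) orbC.
by case: (G y x) (y != x) (val x == a) (val x == b) (val y == a) (val y == b)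
  => [] [] [] [] [] [].
Qed.

Fact add_edge_irrefl G a b : irreflexive (add_edge_rel G a b).
Proof. by move=> x; rewrite /add_edge_rel /= edge_irrefl eqxx. Qed.

Definition add_edge (G : sgraph 'I_n) (a b : nat) : sgraph 'I_n :=
  SGraph (add_edge_sym G a b) (add_edge_irrefl G a b).

(* s lists i_1 <= ... <= i_k with 1 <= k <= m and 1 <= i_j <= m. *)
Definition admissible (m : nat) (s : seq nat) : bool :=
  [&& 1 <= size s <= m, sorted leq s & all (fun i => 1 <= i <= m) s].

Definition H1_admissible (s : seq nat) : bool :=
  [&& odd n, 5 <= n & admissible ((n - 3) %/ 2) s].
Definition H2_admissible (s : seq nat) : bool :=
  [&& ~~ odd n, 4 <= n & admissible ((n - 2) %/ 2) s].
Definition H3_admissible (s : seq nat) : bool :=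
  [&& ~~ odd n, 6 <= n & admissible ((n - 4) %/ 2) s].

Definition H1 (s : seq nat) : sgraph 'I_n :=
  foldl (fun G i => add_edge G i (n - i)) cycle_graph s.
(* H1 and H2 are given by one formula and differ only in the parity of n. *)
Definition H2 (s : seq nat) : sgraph 'I_n :=
  foldl (fun G i => add_edge G i (n - i)) cycle_graph s.
Definition H3 (s : seq nat) : sgraph 'I_n :=
  foldl (fun G i => add_edge G i (n - i - 1)) cycle_graph s.

End Cycles.

Arguments algebraic_connectivity R {T} G.
Arguments H1 : clear implicits.
Arguments H2 : clear implicits.
Arguments H3 : clear implicits.
Arguments H1_admissible : clear implicits.
Arguments H2_admissible : clear implicits.
Arguments H3_admissible : clear implicits.

(* Main.v *)
Require Import Defs.
From mathcomp Require Import all_boot all_order all_algebra all_fingroup.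
From mathcomp Require Import reals.
From mathcomp Require Import polyrcf complex spectral sesquilinear.
From mathcomp Require Import zify ring lra.

(** Why the theorem holds.  Write n = m + 1, and let x be a Fiedler function of
    G: a nonzero eigenfunction of the Laplacian for alpha(G) with sum zero.
    List the vertices so that its values z_0 <= ... <= z_m are nondecreasing,
    and let d_k = z_(k+1) - z_k >= 0.  The term (z_j - z_i)^2 of an edge ij is
    the square of the sum of the gaps d_k between i and j, so the sum E(G) over
    all edges equals the sum over pairs k, l of c(k, l) d_k d_l, where c(k, l)
    counts the edges that span both gaps ([energy_crossing]).  If G is
    2-connected then c(k, k) >= 2, and c(k, k+1) >= 1 because deleting the
    vertex k + 1 does not disconnect G ([cut_connected_crossing]).  The zigzag
    Hamiltonian cycle, with edges {i, i+2}, {0, 1} and {m-1, m}, attains these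
    bounds and has c(k, l) = 0 for all other pairs ([zigzag_crossing]).  Hence
    E(G) >= E(zigzag) ([energy_zigzag_le]), and
      alpha(G) |z|^2 = E(G) >= E(zigzag) >= alpha(C_n) |z|^2.

    If alpha(G) = alpha(C_n), both inequalities are equalities.  The second one
    makes z an eigenvector of the zigzag cycle.  Comparing its eigenvalue
    equations at two consecutive positions with equal values shows that ties
    z_k = z_(k+1) propagate to k - 2 and k + 2 ([tie_balance]); ties of both
    parities would make z constant, hence zero, so either there are no ties or
    the tied gaps are exactly those of one parity p.  The first equality says
    that c(k, l) is minimal at all pairs of untied gaps: at most two edges cross
    an untied gap, and no edge crosses two untied gaps that are not consecutive.
    Exchanging the two vertices of some tied pairs ([straighten]) makes G
    contain the whole zigzag cycle, and every other edge then joins the two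
    vertices of a tied pair ([straight_edges]).  Unfolding the zigzag cycle onto
    C_n turns these pairs into the chords v_i v_(n-i) or v_i v_(n-1-i),
    according to p ([isomorphic_rungs]); for odd n, reversing the order of the
    positions exchanges the two parities, so only the first family remains.

    The spectral input is that a real symmetric matrix is diagonalized by a
    complex unitary matrix with its spectrum on the diagonal.  It yields, for a
    positive semidefinite matrix that kills the constants, an eigenvector for
    the second smallest eigenvalue with sum zero, and the variational inequality
    on sum-zero vectors together with its equality case. *)

Set Implicit Arguments.
Unset Strict Implicit.
Unset Printing Implicit Defensive.

Import Order.TTheory GRing.Theory Num.Theory.

(** * The second smallest eigenvalue of a symmetric matrix *)

Section Spectrum.
Local Open Scope ring_scope.

(** A root of the characteristic polynomial is listed as often as it occurs as
    a linear factor, so a splitting determines the list up to order. *)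
Lemma spectrum_of_split (R : realType) n (A : 'M[R]_n) (s : seq R) :
  char_poly A = \prod_(x <- s) ('X - x%:P) -> perm_eq (spectrum A) s.
Proof.
move=> Es; rewrite /spectrum perm_sort Es; apply/allP => x _ /=.
have p0 : \prod_(y <- s) ('X - y%:P) != 0.
  by rewrite monic_neq0 ?monic_prod_XsubC.
rewrite count_flatten -map_comp sumnE big_map.
under eq_bigr do rewrite /= count_nseq mu_prod_XsubC.
have U : uniq (rootsR (\prod_(y <- s) ('X - y%:P))) by exact: uniq_roots.
have [xs|xs] := boolP (x \in s); last first.
  rewrite (count_memPn xs); apply/eqP/big1 => y _ /=.
  have [->|] := eqVneq y x; last by rewrite mul0n.
  by rewrite (count_memPn xs) muln0.
have xr : x \in rootsR (\prod_(y <- s) ('X - y%:P)).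
  by rewrite -roots_on_rootsR // inE /= root_prod_XsubC.
rewrite (bigD1_seq x) //= eqxx mul1n big1 ?addn0 // => y /negbTE ->.
by rewrite mul0n.
Qed.

Lemma conj_real_complex (R : rcfType) (x : R) : (x%:C)%C^* = x%:C%C.
Proof. by apply/CrealP/complex_realP; exists x. Qed.

Lemma char_poly_conj (F : fieldType) n (P A : 'M[F]_n) :
  P \in unitmx -> char_poly (invmx P *m A *m P) = char_poly A.
Proof.
move=> uP; pose f (M : 'M[F]_n) := map_mx (@polyC F) M.
have uf : f (invmx P) *m f P = 1%:M by rewrite /f -map_mxM mulVmx // map_mx1.
rewrite /char_poly.
have -> : char_poly_mx (invmx P *m A *m P) =
    f (invmx P) *m char_poly_mx A *m f P.
  rewrite /char_poly_mx mulmxBr mulmxBl -scalemx1 -scalemxAr -scalemxAl mulmx1.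
  by rewrite uf /f !map_mxM.
by rewrite !det_mulmx mulrAC -det_mulmx uf det1 mul1r.
Qed.

Local Open Scope sesquilinear_scope.

(** Real symmetric matrices are hermitian over the complex numbers, where the
    spectral theorem applies; the eigenvalues being real, the characteristic
    polynomial splits over R. Permuting the rows of the unitary matrix puts the
    eigenvalues in the order of [spectrum]. *)
Lemma symmetric_diagonalization (R : realType) n (A : 'M[R]_n) : A^T = A ->
  size (spectrum A) = n /\
  exists2 P : 'M[R[i]]_n, P \is unitarymx &
    map_mx (real_complex R) A =
      P^t* *m diag_mx (\row_(i < n) ((spectrum A)`_i)%:C%C) *m P.
Proof.
move=> symA; pose B := map_mx (real_complex R) A.
have Breal : B \is a realmx.
  by apply/mxOverP => i j; rewrite mxE; apply/complex_realP; exists (A i j).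
have Bherm : B \is hermsymmx.
  apply: realsym_hermsym => //; apply/is_hermitianmxP.
  by rewrite expr0 scale1r map_mx_id // /B map_trmx symA.
have PU := spectral_unitarymx B; set P := spectralmx B in PU.
have /orthomx_spectralP := hermitian_normalmx Bherm.
rewrite -/P => EB.
have dreal := hermitian_spectral_diag_real Bherm.
pose d := map_mx (@complex.Re R) (spectral_diag B).
have dE : spectral_diag B = map_mx (real_complex R) d.
  by apply/rowP => i; rewrite !mxE RRe_real //; apply/mxOverP.
have charA :
    char_poly A = \prod_(x <- [seq d 0 i | i <- enum 'I_n]) ('X - x%:P).
  rewrite big_map big_enum /=.
  apply: (map_poly_inj (real_complex R)).
  rewrite map_char_poly -/B EB dE char_poly_conj ?unitarymx_unit //.
  rewrite char_poly_trig ?diag_mx_is_trig // rmorph_prod.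
  apply: eq_bigr => i _.
  by rewrite !mxE eqxx mulr1n rmorphB /= map_polyX map_polyC.
have Ep := spectrum_of_split charA.
have sz : size (spectrum A) == n.
  by rewrite (perm_size Ep) size_map size_enum_ord.
have /tuple_permP[s Es] :
    perm_eq (Tuple sz) [tuple of [seq d 0 i | i <- ord_tuple n]] by [].
have nthE (i : 'I_n) : (spectrum A)`_i = d 0 (s i).
  have -> : (spectrum A)`_i = tnth (Tuple sz) i by rewrite (tnth_nth 0).
  by rewrite (tnth_nth 0) Es -tnth_nth tnth_mktuple tnth_map tnth_ord_tuple.
split; first exact/eqP.
exists (row_perm s P).
  rewrite row_permE; apply: mul_unitarymx PU; apply/unitarymxP.
  rewrite tr_perm_mx map_perm_mx -perm_mxM mulgV; exact: perm_mx1.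
rewrite -/B {1}EB invmx_unitary // dE; apply/matrixP => a b.
rewrite !mul_mx_diag !mxE (reindex_perm s) /=.
by apply: eq_bigr => i _; rewrite !mxE nthE !mxE.
Qed.

End Spectrum.

(** The abstract setting of the Laplacian: a positive semidefinite symmetric
    matrix whose kernel contains the all-one vector. Indices start at 0, so the
    second smallest eigenvalue is at n - 2. *)
Section Fiedler.
Local Open Scope ring_scope.
Local Open Scope sesquilinear_scope.
Variables (R : realType) (n : nat) (A : 'M[R]_n).
Hypotheses (n_gt1 : (1 < n)%N) (symA : A^T = A).
Let one : 'rV[R]_n := const_mx 1.
Hypotheses (kerA : one *m A = 0).
Hypothesis psdA : forall y : 'rV[R]_n, 0 <= (y *m A *m y^T) 0 0.

Let lam (i : 'I_n) := (spectrum A)`_i.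
Let alpha := (spectrum A)`_(n - 2).

Let spectrum_size_n : size (spectrum A) = n.
Proof. by case: (symmetric_diagonalization symA). Qed.

Lemma lam_noninc (i j : 'I_n) : (i <= j)%N -> lam j <= lam i.
Proof.
move=> ij; rewrite /lam.
have srt : sorted >=%R (spectrum A) by apply: sort_sorted; exact: ge_total.
apply: (sorted_leq_nth ge_trans ge_refl 0 srt) => //;
  by rewrite inE spectrum_size_n.
Qed.

Lemma lam_eigen (i : 'I_n) : exists2 v : 'rV[R]_n, v *m A = lam i *: v & v != 0.
Proof.
apply/eigenvalueP; rewrite eigenvalue_root_char.
have : lam i \in spectrum A by rewrite mem_nth ?spectrum_size_n.
rewrite mem_sort => /flattenP[s /mapP[x xr ->]].
rewrite mem_nseq => /andP[_ /eqP->]; move: xr.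
by rewrite -roots_on_rootsR ?monic_neq0 ?char_poly_monic // => /andP[].
Qed.

Lemma sqr_norm_gt0 (v : 'rV[R]_n) : v != 0 -> 0 < (v *m v^T) 0 0.
Proof.
move=> v0; rewrite mxE lt_neqAle sumr_ge0 ?andbT; last first.
  by move=> i _; rewrite mxE -expr2 sqr_ge0.
rewrite eq_sym; apply: contra v0 => /eqP /psumr_eq0P v0.
apply/eqP/rowP => i; rewrite mxE; apply/eqP; rewrite -sqrf_eq0 expr2.
have := v0 _ i isT; rewrite mxE => -> // j _; by rewrite mxE -expr2 sqr_ge0.
Qed.

Lemma lam_ge0 i : 0 <= lam i.
Proof.
have [v Ev v0] := lam_eigen i; have := psdA v.
by rewrite Ev -scalemxAl mxE pmulr_lge0 // sqr_norm_gt0.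
Qed.

Local Notation toC := (map_mx (real_complex R)).

(** In an orthonormal eigenbasis both sides are sums of the squared coordinates
    w_i of y, with weights lambda_i on the right and alpha on the left. Only
    the last eigenvalue can be below alpha; in that case it is a simple
    eigenvalue, its eigenspace is spanned by the all-one vector, and the
    corresponding coordinate of y vanishes. In the equality case every
    coordinate with lambda_i <> alpha vanishes. *)
Lemma second_eigenvalue_le_form (y : 'rV[R]_n) : y *m one^T = 0 ->
  alpha * (y *m y^T) 0 0 <= (y *m A *m y^T) 0 0 /\
  (alpha * (y *m y^T) 0 0 = (y *m A *m y^T) 0 0 -> y *m A = alpha *: y).
Proof.
move=> y1; have [_ [P PU EA]] := symmetric_diagonalization symA.
set D := diag_mx _ in EA.
have a_lt : (n - 2 < n)%N by rewrite ltn_subrL (ltnW n_gt1).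
have l_lt : (n - 1 < n)%N by rewrite ltn_subrL (ltnW n_gt1).
pose a := Ordinal a_lt; pose l := Ordinal l_lt.
have PtP : P^t* *m P = 1%:M.
  by rewrite -invmx_unitary // mulVmx // unitarymx_unit.
pose coord (v : 'rV[R]_n) := toC v *m P^t*.
have coordK v : toC v = coord v *m P by rewrite -mulmxA PtP mulmx1.
have conjC v : (toC v)^t* = toC v^T.
  by apply/matrixP => i j; rewrite !mxE conj_real_complex.
have coordA v : coord (v *m A) = coord v *m D.
  rewrite /coord map_mxM EA !mulmxA -[_ *m P *m _]mulmxA.
  by have /unitarymxP-> := PU; rewrite mulmx1.
have coord_dot u v :
    ((u *m v^T) 0 0)%:C%C = \sum_i coord u 0 i * (coord v 0 i)^*.
  have -> : ((u *m v^T) 0 0)%:C%C = (toC u *m (toC v)^t*) 0 0.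
    by rewrite conjC -map_mxM [RHS]mxE.
  rewrite (coordK u) (coordK v) trmx_mul map_mxM mulmxA -[_ *m P *m _]mulmxA.
  have /unitarymxP-> := PU; rewrite mulmx1 mxE.
  by apply: eq_bigr => i _; rewrite !mxE.
have coordAE v i : coord (v *m A) 0 i = (lam i)%:C%C * coord v 0 i.
  by rewrite coordA mul_mx_diag !mxE mulrC.
pose w i : R := complex.Re (coord y 0 i) ^+ 2 + complex.Im (coord y 0 i) ^+ 2.
have wE i : (w i)%:C%C = coord y 0 i * (coord y 0 i)^*.
  by rewrite add_Re2_Im2 normCK.
have w_ge0 i : 0 <= w i by rewrite addr_ge0 ?sqr_ge0.
have w_eq0 i : w i = 0 -> coord y 0 i = 0.
  move=> w0; apply/eqP; rewrite -normr_eq0 -sqrf_eq0 -add_Re2_Im2.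
  by rewrite -/(w i) w0.
have norm_y : (y *m y^T) 0 0 = \sum_i w i.
  apply: (@complexI R); rewrite coord_dot rmorph_sum.
  by apply: eq_bigr => i _; rewrite -wE.
have form_y : (y *m A *m y^T) 0 0 = \sum_i lam i * w i.
  apply: (@complexI R); rewrite coord_dot rmorph_sum.
  by apply: eq_bigr => i _; rewrite rmorphM /= wE coordAE mulrA.
(* If the eigenvalue at the last index l is below alpha, then all others are
   positive, so the all-one vector has no coordinate outside l. *)
have term_ge0 i : 0 <= (lam i - alpha) * w i.
  have [lt_al|le_al] := ltP (lam l) alpha; last first.
    rewrite mulr_ge0 // subr_ge0 (le_trans le_al) // lam_noninc //.
    by have := ltn_ord i; rewrite /=; lia.
  have above j : j != l -> alpha <= lam j.
    move=> jl; apply: (@lam_noninc j a); rewrite /=.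
    have : (j != n - 1 :> nat)%N by []; have := ltn_ord j; lia.
  have one0 j : j != l -> coord one 0 j = 0.
    move=> jl; have := coordAE one j; rewrite kerA /coord map_mx0 mul0mx mxE.
    move=> /esym/eqP; rewrite mulf_eq0 => /orP[|/eqP //].
    rewrite -[0]/(0%:C%C) (inj_eq (@complexI R)) => /eqP l0.
    have := lt_le_trans lt_al (above _ jl); rewrite l0.
    by rewrite ltNge lam_ge0.
  have onel : coord one 0 l != 0.
    apply/eqP => one_l; have : coord one = 0.
      apply/rowP => j; rewrite [RHS]mxE; have [-> //|/one0//] := eqVneq j l.
    move/(congr1 (mulmx^~ P)); rewrite -coordK mul0mx => /rowP/(_ l).
    by rewrite !mxE => /eqP; rewrite (inj_eq (@complexI R) 1 0) oner_eq0.
  have [->|/above lam_i] := eqVneq i l; last by rewrite mulr_ge0 // subr_ge0.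
  have -> : w l = 0; last by rewrite mulr0.
  have := coord_dot y one; rewrite y1 mxE (bigD1 l) //= big1 ?addr0; last first.
    by move=> j /one0->; rewrite conjC0 mulr0.
  move=> /esym/eqP; rewrite mulf_eq0 conjC_eq0 (negbTE onel) orbF => /eqP yl.
  by apply: (@complexI R); rewrite wE yl mul0r.
have gap : (y *m A *m y^T) 0 0 - alpha * (y *m y^T) 0 0 =
           \sum_i (lam i - alpha) * w i.
  rewrite norm_y form_y mulr_sumr -sumrB.
  by apply: eq_bigr => i _; rewrite mulrBl.
split; first by rewrite -subr_ge0 gap sumr_ge0.
move/esym/eqP; rewrite -subr_eq0 gap => /eqP/psumr_eq0P terms0.
apply: (map_mx_inj (f := real_complex R)).
rewrite coordK coordA [RHS]map_mxZ (coordK y) scalemxAl; congr (_ *m P).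
apply/rowP => i; rewrite -coordA coordAE [RHS]mxE.
have /eqP := terms0 (fun j _ => term_ge0 j) i isT.
rewrite mulf_eq0 subr_eq0 => /orP[/eqP-> //|/eqP/w_eq0->].
by rewrite !mulr0.
Qed.

(** A nonzero alpha has eigenvectors orthogonal to the kernel. If alpha = 0,
    the kernel has dimension at least 2 and meets the hyperplane of sum-zero
    vectors in a nonzero vector. *)
Lemma second_eigenvector_sum0 :
  exists2 x : 'rV[R]_n, x != 0 & x *m one^T = 0 /\ x *m A = alpha *: x.
Proof.
have [_ [P PU EA]] := symmetric_diagonalization symA.
have a_lt : (n - 2 < n)%N by rewrite ltn_subrL (ltnW n_gt1).
have [alpha0|alpha_neq0] := eqVneq alpha 0; last first.
  have [x Ex x0] := lam_eigen (Ordinal a_lt); exists x => //; split => //.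
  have : x *m A *m one^T = 0.
    by rewrite -mulmxA -{1}symA -trmx_mul kerA trmx0 mulmx0.
  rewrite Ex -scalemxAl => /eqP.
  by rewrite scaler_eq0 (negbTE alpha_neq0) => /eqP.
have low_eig (i : 'I_n) : (n - 2 <= i)%N -> lam i = 0.
  move=> le_i; apply/eqP; rewrite eq_le lam_ge0 andbT -alpha0.
  exact: (@lam_noninc (Ordinal a_lt) i).
(* The last two rows of the unitary matrix are independent complex kernel
   vectors, and the rank does not depend on the field. *)
have rkA : (1 < \rank (kermx A))%N.
  rewrite mxrank_ker -(mxrank_map (real_complex R)) -mxrank_ker.
  have : (copid_mx (n - 2) *m P <= kermx (toC A))%MS.
    apply/sub_kermxP; rewrite EA 2!mulmxA -[_ *m P *m _]mulmxA.
    have /unitarymxP-> := PU; rewrite mulmx1 -[RHS](mul0mx _ P); congr (_ *m P).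
    rewrite mul_mx_diag; apply/matrixP => i j; rewrite !mxE.
    have [<-|ij] := eqVneq i j; last first.
      by rewrite (inj_eq val_inj) (negbTE ij) subr0 mul0r.
    rewrite eqxx /=; have [lt_i|/low_eig] := ltnP i (n - 2).
      by rewrite subrr mul0r.
    by rewrite /lam => ->; rewrite mulr0.
  move/mxrankS; apply: leq_trans.
  rewrite mxrankMfree ?row_free_unit ?unitarymx_unit //.
  by rewrite rank_copid_mx ?leq_subr // subKn.
have rk1 : (n - 1 <= \rank (kermx one^T))%N.
  by rewrite mxrank_ker leq_sub2l // (leq_trans (rank_leq_col _)).
have : (kermx A :&: kermx one^T)%MS != 0.
  rewrite -mxrank_eq0 -lt0n.
  have := mxrank_sum_cap (kermx A) (kermx one^T).
  have := rank_leq_col (kermx A + kermx one^T)%MS.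
  move: rkA rk1 n_gt1; lia.
case/rowV0Pn => x; rewrite sub_capmx => /andP[/sub_kermxP xA /sub_kermxP x1] x0.
by exists x => //; rewrite xA alpha0 scale0r.
Qed.

End Fiedler.

(** * Laplacian energy of a graph *)

Section Energy.
Local Open Scope ring_scope.

(** The sum runs over ordered pairs of vertices, so each edge is counted twice:
    this is twice the quadratic form of the Laplacian. *)
Definition energy (R : realType) (T : finType) (G : rel T) (x : T -> R) : R :=
  \sum_u \sum_v (G u v)%:R * (x u - x v) ^+ 2.

Section GraphLaplacian.
Variables (R : realType) (T : finType) (G : sgraph T).
Local Notation L := (laplacian R G).

Definition laplacian_op (x : T -> R) (u : T) : R :=
  \sum_v (G u v)%:R * (x u - x v).

Let vec (x : T -> R) : 'rV[R]_#|T| := \row_i x (enum_val i).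

Lemma sum_enum_val (F : T -> R) : \sum_(i < #|T|) F (enum_val i) = \sum_u F u.
Proof. by rewrite -(big_enum_val F); apply: eq_bigl => u. Qed.

Lemma laplacian_sym : L^T = L.
Proof.
apply/matrixP => i j; rewrite !mxE edge_sym.
by have [->|] := eqVneq j i.
Qed.

Lemma vec_laplacian x : vec x *m L = vec (laplacian_op x).
Proof.
apply/rowP => j; rewrite /laplacian mulmxBr mul_mx_diag !mxE.
under eq_bigr do rewrite !mxE.
rewrite (sum_enum_val (fun v => x v * (G v (enum_val j))%:R)).
rewrite /degree -sum1dep_card natr_sum mulr_sumr big_mkcond -sumrB /=.
apply: eq_bigr => v _; rewrite (edge_sym G v).
by case: (G _ v); rewrite /=; ring.
Qed.

Lemma vec_dot x y : (vec x *m (vec y)^T) 0 0 = \sum_u x u * y u.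
Proof.
rewrite mxE -(sum_enum_val (fun u => x u * y u)).
by apply: eq_bigr => i _; rewrite !mxE.
Qed.

Lemma energy_laplacian (x : T -> R) :
  energy G x = 2 * \sum_u laplacian_op x u * x u.
Proof.
have E1 : \sum_u laplacian_op x u * x u =
    \sum_u \sum_v (G u v)%:R * (x u - x v) * x u.
  by apply: eq_bigr => u _; rewrite mulr_suml.
have E2 : \sum_u laplacian_op x u * x u =
    \sum_u \sum_v (G u v)%:R * (x v - x u) * x v.
  rewrite E1 exchange_big /=.
  by do 2!apply: eq_bigr => ? _; rewrite edge_sym.
rewrite mulr_natl mulr2n {1}E1 E2 -big_split /=.
by apply: eq_bigr => u _; rewrite -big_split /=; apply: eq_bigr => v _; ring.
Qed.

Lemma energy_ge0 (x : T -> R) : 0 <= energy G x.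
Proof. by do 2!apply: sumr_ge0 => ? _; rewrite mulr_ge0 ?sqr_ge0. Qed.

Lemma vecK (v : 'rV[R]_#|T|) : v = vec (fun u => v 0 (enum_rank u)).
Proof. by apply/rowP => i; rewrite mxE enum_valK. Qed.

Lemma vec1 : (const_mx 1 : 'rV_#|T|) = vec (fun=> 1).
Proof. by apply/rowP => i; rewrite !mxE. Qed.

Lemma laplacian_const : (const_mx 1 : 'rV_#|T|) *m L = 0.
Proof.
rewrite vec1 vec_laplacian; apply/rowP => i; rewrite !mxE /laplacian_op.
by apply: big1 => v _; rewrite subrr mulr0.
Qed.

Lemma laplacian_psd (y : 'rV_#|T|) : 0 <= (y *m L *m y^T) 0 0.
Proof.
rewrite (vecK y) vec_laplacian vec_dot -(@pmulr_rge0 _ 2) // -energy_laplacian.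
exact: energy_ge0.
Qed.

Hypothesis T_gt1 : (1 < #|T|)%N.
Local Notation alpha := (algebraic_connectivity R G).

Lemma energy_ge_algebraic_connectivity y : \sum_u y u = 0 ->
  2 * alpha * (\sum_u y u ^+ 2) <= energy G y /\
  (energy G y = 2 * alpha * (\sum_u y u ^+ 2) ->
   forall u, laplacian_op y u = alpha * y u).
Proof.
move=> y0; have y1 : vec y *m (const_mx 1 : 'rV_#|T|)^T = 0.
  apply/matrixP => i j; rewrite !ord1 vec1 vec_dot mxE -[RHS]y0.
  by apply: eq_bigr => u _; rewrite mulr1.
have [ge_y eq_y] := second_eigenvalue_le_form T_gt1 laplacian_sym
  laplacian_const laplacian_psd y1.
have normy : (vec y *m (vec y)^T) 0 0 = \sum_u y u ^+ 2.
  by rewrite vec_dot; apply: eq_bigr => u _; rewrite expr2.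
rewrite normy vec_laplacian vec_dot in ge_y eq_y.
rewrite energy_laplacian -mulrA; split; first by rewrite ler_pM2l.
have two0 : (2 : R) != 0 by rewrite pnatr_eq0.
move=> /(mulfI two0) E u.
have /rowP/(_ (enum_rank u)) := eq_y (esym E).
by rewrite !mxE enum_rankK.
Qed.

(** Equality is attained in the inequality above, so a lower bound for the
    energy of this one function is a lower bound for alpha(G). *)
Lemma fiedler_function : exists x : T -> R,
  [/\ exists u, x u != 0, \sum_u x u = 0 &
      energy G x = 2 * alpha * \sum_u x u ^+ 2].
Proof.
have [v v0 [v1 Lv]] := second_eigenvector_sum0 T_gt1 laplacian_sym
  laplacian_const laplacian_psd.
exists (fun u => v 0 (enum_rank u)); split.
- by have /rV0Pn[i vi] := v0; exists (enum_val i); rewrite enum_valK.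
- have /matrixP/(_ 0 0) := v1; rewrite (vecK v) vec1 vec_dot mxE => E.
  by rewrite -[RHS]E; apply: eq_bigr => u _; rewrite -vecK mulr1.
rewrite energy_laplacian -mulrA; congr (_ * _); rewrite mulr_sumr.
apply: eq_bigr => u _; move: Lv; rewrite {1}(vecK v) vec_laplacian.
by move/rowP/(_ (enum_rank u)); rewrite !mxE enum_rankK => ->;
  rewrite -mulrA expr2.
Qed.

End GraphLaplacian.

Lemma energy_iso (R : realType) (T U : finType) (g : rel T) (h : rel U)
    (f : T -> U) (x : U -> R) :
  bijective f -> (forall a b, h (f a) (f b) = g a b) ->
  energy h x = energy g (x \o f).
Proof.
move=> bij_f fE; rewrite /energy (reindex f) /=; last exact: onW_bij.
apply: eq_bigr => u _; rewrite (reindex f) /=; last exact: onW_bij.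
by apply: eq_bigr => v _; rewrite fE.
Qed.

End Energy.

(** * Vertex cuts of 2-connected graphs *)

(** Deleting any single vertex v leaves G connected. Stated for edges across an
    arbitrary bipartition, which is the form used for counting edges. *)
Definition cut_connected (T : finType) (G : rel T) : Prop :=
  forall (v : T) (S : pred T) (s t : T), S s -> ~~ S t -> s != v -> t != v ->
  exists a b, [/\ S a, ~~ S b, a != v, b != v & G a b].

Lemma path_crosses (T : eqType) (e : rel T) (S : pred T) x p :
  path e x p -> S x -> ~~ S (last x p) ->
  exists a b, [/\ a \in x :: p, b \in x :: p, S a, ~~ S b & e a b].
Proof.
elim: p x => [|y p IHp] x /=; first by move=> _ ->.
case/andP=> xy yp Sx Sl; have [Sy|Sy] := boolP (S y); last first.
  by exists x, y; rewrite !inE !eqxx !orbT.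
have [a [b [ap bp Sa Sb ab]]] := IHp y yp Sy Sl.
by exists a, b; split; rewrite // inE ?ap ?bp orbT.
Qed.

Section TwoConnectedCuts.
Variables (T : finType) (G : sgraph T).
Hypothesis conn_G : two_connected G.

Lemma two_inner_disjoint_paths (u w : T) : u != w ->
  exists p q : #|T|.-bseq T, [/\ is_upath G u w p, is_upath G u w q, p != q &
    inner_disjoint u w p q].
Proof.
move=> uw; have [P /andP[dP P1]|none] :=
  pickP [pred P | disjoint_paths G u w P & 1 < #|P|]; last first.
  have := conn_G.2 u w uw; rewrite ltnNge => /negP[]; apply/bigmax_leqP => P dP.
  by rewrite leqNgt; apply/negP => P1; have := none P; rewrite /= dP P1.
have [p [q [pP qP pq]]] := card_gt1P P1; exists p, q.
case/andP: dP => /forall_inP path_P /forall_inP/(_ p pP)/forall_inP/(_ q qP).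
by rewrite pq /= => dis; split; rewrite ?path_P.
Qed.

(** Of two inner disjoint paths from s to t at least one avoids v, and it has
    to leave S along an edge. *)
Lemma two_connected_cut_connected : cut_connected G.
Proof.
move=> v S s t Ss St sv tv.
have st : s != t by apply: contraNneq St => <-.
have [p [q [up uq _ /forallP/(_ v) dis]]] := two_inner_disjoint_paths st.
have [r [/and3P[pr /eqP lr _] vr]] :
    exists r : #|T|.-bseq T, is_upath G s t r /\ v \notin s :: r.
  have [vp|] := boolP (v \in s :: p); last by exists p.
  exists q; split=> //; apply/negP => vq; move: dis; rewrite vp vq /=.
  by rewrite eq_sym (negbTE sv) eq_sym (negbTE tv).
have [||a [b [ar br Sa Sb ab]]] := @path_crosses _ _ S _ _ pr => //.
  by rewrite lr.
exists a, b; split=> //; first by apply: contraNneq vr => <-.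
by apply: contraNneq vr => <-.
Qed.

(** On two vertices the only path is the single edge, and a simple graph has no
    second one. *)
Lemma two_connected_order : 2 < #|T|.
Proof.
have [u [w [_ _ uw]]] := card_gt1P conn_G.1.
have [p [q [up uq pq _]]] := two_inner_disjoint_paths uw.
rewrite ltnNge; apply/negP => T2.
have short (r : #|T|.-bseq T) : is_upath G u w r -> r = [:: w] :> seq T.
  case/and3P=> _ /eqP lr ur; have := leq_trans (max_card (mem (u :: r))) T2.
  have /card_uniqP-> := ur; move: lr; case: (val r) => [|x [|y s]] //=.
    by move/eqP; rewrite (negbTE uw).
  by move->.
by case/eqP: pq; apply: val_inj; exact: etrans (short p up) (esym (short q uq)).
Qed.

End TwoConnectedCuts.

(** * The zigzag cycle has the least energy *)

Section Crossings.
Variable m : nat.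
Local Notation vertex := 'I_m.+1.

(** The Hamiltonian cycle 0, 2, 4, ..., 5, 3, 1 on the positions 0, ..., m. *)
Definition zigzag : rel vertex :=
  [rel i j : vertex |
    [|| i.+2 == j, j.+2 == i, i + j == 1 | i + j == m + m.-1]].

(** Edges, oriented upwards, that span every gap between positions q and q + 1
    with k <= q <= l. *)
Definition crossing (g : rel vertex) (k l : nat) : {set vertex * vertex} :=
  [set e | [&& g e.1 e.2, e.1 <= k & l < e.2]].

Lemma zigzag_sym : symmetric zigzag.
Proof. by move=> i j; rewrite /zigzag /= (addnC j) orbCA. Qed.

Lemma zigzag_crossing k l : 1 < m -> k <= l < m ->
  #|crossing zigzag k l| <= if k == l then 2 else (l == k.+1).
Proof.
move=> m1 /andP[kl lm].
have [<-|k_neq_l] := eqVneq k l.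
  (* The only candidates are (k-1, k+1) and (k, k+2); at the two ends of the
     order the edges (0, 1) and (m-1, m) take over. *)
  pose a : vertex * vertex :=
    if k is k'.+1 then (inord k', inord k.+1) else (inord 0, inord 1).
  pose b : vertex * vertex :=
    if k.+2 <= m then (inord k, inord k.+2) else (inord m.-1, inord m).
  suff /subset_leq_card : crossing zigzag k k \subset [set a; b].
    by move/leq_trans; apply; rewrite cards2; case: (a == b).
  apply/subsetP => -[i j]; rewrite !inE /= => /and3P[];
    rewrite /zigzag /= => zij ik kj.
  have im := ltn_ord i; have jm := ltn_ord j.
  rewrite /a /b; case: (k) ik kj => [|k'] ik kj; case: ifP => km;
    rewrite !xpair_eqE -!val_eqE /= !inordK; lia.
have [lk|lk] := eqVneq l k.+1.
  suff /subset_leq_card : crossing zigzag k l \subset [set (inord k,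
    inord k.+2)].
    by rewrite cards1.
  apply/subsetP => -[i j]; rewrite !inE /= => /and3P[];
    rewrite /zigzag /= => zij ik kj.
  have im := ltn_ord i; have jm := ltn_ord j.
  rewrite !xpair_eqE -!val_eqE /= !inordK; lia.
suff -> : crossing zigzag k l = set0 by rewrite cards0.
apply/setP => -[i j]; rewrite !inE /=; apply/negP => /and3P[];
  rewrite /zigzag /= => zij ik kj.
have im := ltn_ord i; have jm := ltn_ord j; lia.
Qed.

Variable g : rel vertex.
Hypothesis cut_g : cut_connected g.

Lemma initial_cut (v : vertex) k :
  (exists2 s : vertex, s <= k & s != v) ->
  (exists2 t : vertex, k < t & t != v) ->
  exists a b : vertex, [/\ a <= k, k < b, a != v, b != v & g a b].
Proof.
move=> [s sk sv] [t kt tv].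
have [||a [b [ak bk av bv ab]]] :=
  cut_g (S := fun i : vertex => i <= k) _ _ sv tv => //.
  by rewrite -ltnNge.
by exists a, b; rewrite ltnNge.
Qed.

(** For k = l, two edges are needed: the side of the cut with at least two
    vertices provides them, the second edge being found after deletion of the
    end of the first edge on that side. For l = k + 1, an edge that avoids the
    vertex k + 1 is needed. *)
Lemma cut_connected_crossing k l : 1 < m -> k <= l < m ->
  (if k == l then 2 else (l == k.+1)) <= #|crossing g k l|.
Proof.
move=> m1 /andP[kl lm]; have [<-|k_neq_l] := eqVneq k l; last first.
  have [lk|//] := eqVneq l k.+1; subst l.
  have [||a [b [ak kb av bv ab]]] := @initial_cut (inord k.+1) k.
  - by exists (inord k); rewrite -?val_eqE /= !inordK; lia.
  - by exists (inord k.+2); rewrite -?val_eqE /= !inordK; lia.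
  apply/card_gt0P; exists (a, b); rewrite inE /= ab ak.
  by move: bv; rewrite -val_eqE /= inordK; lia.
suff [e [f [eX fX ef]]] : exists e f : vertex * vertex,
    [/\ e \in crossing g k k, f \in crossing g k k & e != f].
  by apply/card_gt1P; exists e, f.
have [k0|k0] := posnP k.
  have [||a [b [ak kb av bv ab]]] := @initial_cut (inord m) k.
  - by exists (inord 0); rewrite -?val_eqE /= !inordK; lia.
  - by exists (inord 1); rewrite -?val_eqE /= !inordK; lia.
  have [||a' [b' [ak' kb' av' bv' ab']]] := @initial_cut b k.
  - by exists (inord 0); rewrite -?val_eqE /= !inordK; lia.
  - by exists (inord m); rewrite 1?eq_sym // inordK; lia.
  exists (a, b), (a', b'); rewrite !inE /= ab ak kb ab' ak' kb'; split=> //.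
  by rewrite xpair_eqE negb_and (eq_sym b) bv' orbT.
have [||a [b [ak kb av bv ab]]] := @initial_cut (inord 0) k.
- by exists (inord k); rewrite -?val_eqE /= !inordK; lia.
- by exists (inord k.+1); rewrite -?val_eqE /= !inordK; lia.
have [||a' [b' [ak' kb' av' bv' ab']]] := @initial_cut a k.
- by exists (inord 0); rewrite 1?eq_sym // inordK; lia.
- by exists (inord k.+1); rewrite -?val_eqE /= !inordK; lia.
exists (a, b), (a', b'); rewrite !inE /= ab ak kb ab' ak' kb'; split=> //.
by rewrite xpair_eqE negb_and (eq_sym a) av'.
Qed.

End Crossings.

Section EnergyExpansion.
Local Open Scope ring_scope.
Variables (R : realType) (m : nat) (z : nat -> R).
Local Notation vertex := 'I_m.+1.
Local Notation zvec := (fun i : vertex => z i).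
Let gap k := z k.+1 - z k.

(** Telescoping, written over all gaps so that squares expand uniformly. *)
Lemma sum_gaps (i j : vertex) : (i <= j)%N ->
  z j - z i = \sum_(k < m) ((i <= k)%N && (k < j)%N)%:R * gap k.
Proof.
move=> ij; rewrite -(telescope_sumr z ij).
rewrite (big_nat_widen _ _ m) ?big_nat_widenl; last by rewrite -ltnS.
rewrite (big_nat_widenl _ 0%N) // big_mkord big_mkcond /=.
apply: eq_bigr => k _; rewrite andbC.
by case: ifP => _; rewrite ?mul1r ?mul0r.
Qed.

(** Expanding the square of each difference into gaps and exchanging the sums
    turns the energy into a form in the gaps with crossing numbers as
    coefficients. *)
Lemma energy_crossing (g : rel vertex) : symmetric g ->
  energy g zvec =
  2 * \sum_(k < m) \sum_(l < m)
    (#|crossing g (minn k l) (maxn k l)|)%:R * (gap k * gap l).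
Proof.
move=> symg.
pose F (i j : vertex) := (g i j)%:R * (z i - z j) ^+ 2.
have symF i j : F i j = F j i by rewrite /F symg; ring.
have -> : energy g zvec =
    2 * \sum_(i < m.+1) \sum_(j < m.+1 | (i < j)%N) F i j.
  have E1 : energy g zvec =
      \sum_(i < m.+1) \sum_(j < m.+1 | (i < j)%N) F i j +
      \sum_(i < m.+1) \sum_(j < m.+1 | (j < i)%N) F i j.
    rewrite -big_split; apply: eq_bigr => i _ /=.
    rewrite (bigID (fun j : vertex => (i < j)%N)) /=; congr (_ + _).
    rewrite (bigID (fun j : vertex => j == i)) /= [X in X + _]big1 ?add0r.
      by apply: eq_bigl => j; rewrite -leqNgt ltn_neqAle andbC.
    by move=> j /andP[_ /eqP->]; rewrite subrr expr0n mulr0.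
  have E2 : \sum_(i < m.+1) \sum_(j < m.+1 | (j < i)%N) F i j =
      \sum_(i < m.+1) \sum_(j < m.+1 | (i < j)%N) F i j.
    rewrite (exchange_big_dep predT) //=.
    by apply: eq_bigr => i _; apply: eq_bigr => j _; rewrite symF.
  by rewrite E1 E2; ring.
congr (_ * _).
have expand (i j : vertex) : (i < j)%N -> F i j = \sum_(k < m) \sum_(l < m)
    ((i, j) \in crossing g (minn k l) (maxn k l))%:R * (gap k * gap l).
  move=> ij; rewrite /F -sqrrN opprB (sum_gaps (ltnW ij)) expr2 mulr_suml.
  rewrite mulr_sumr; apply: eq_bigr => k _; rewrite mulr_sumr mulr_sumr.
  apply: eq_bigr => l _; rewrite inE /= leq_min gtn_max.
  by case: (g i j) (i <= k)%N (i <= l)%N (k < j)%N (l < j)%N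
    => [] [] [] [] [] /=; ring.
rewrite pair_big_dep /=.
under eq_bigr => p ij do rewrite expand //.
rewrite exchange_big; apply: eq_bigr => k _ /=.
rewrite exchange_big; apply: eq_bigr => l _ /=.
rewrite -mulr_suml; congr (_ * _).
rewrite -sum1_card natr_sum [RHS]big_mkcond [LHS]big_mkcond /=.
apply: eq_bigr => -[i j] _ /=; case: ifPn => [_|]; first by case: (_ \in _).
by rewrite -leqNgt => ji; case: ifP => //; rewrite inE /=; lia.
Qed.

Hypothesis m_gt1 : (1 < m)%N.
Hypothesis z_mono : forall k, (k < m)%N -> z k <= z k.+1.

(** All gaps are nonnegative, so the coefficientwise comparison of crossing
    numbers gives the inequality. Equality forces equal crossing numbers at
    each pair of gaps that are both nonzero. *)
Lemma energy_zigzag_le (g : rel vertex) : symmetric g -> cut_connected g ->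
  energy (@zigzag m) zvec <= energy g zvec /\
  (energy g zvec = energy (@zigzag m) zvec ->
   forall k l, (k <= l < m)%N -> z k != z k.+1 -> z l != z l.+1 ->
   (#|crossing g k l| <= if k == l then 2 else (l == k.+1))%N).
Proof.
move=> symg cutg.
pose excess (k l : nat) : R :=
  #|crossing g (minn k l) (maxn k l)|%:R -
  #|crossing (@zigzag m) (minn k l) (maxn k l)|%:R.
have excess_ge0 (k l : 'I_m) : 0 <= excess k l.
  rewrite subr_ge0 ler_nat.
  have kl : (minn k l <= maxn k l < m)%N.
    have := ltn_ord k; have := ltn_ord l; lia.
  apply: leq_trans (zigzag_crossing m_gt1 kl) _.
  exact: cut_connected_crossing.
have gap_ge0 (k : 'I_m) : 0 <= gap k by rewrite subr_ge0 z_mono.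
have diff : energy g zvec - energy (@zigzag m) zvec
    = 2 * \sum_(k < m) \sum_(l < m) excess k l * (gap k * gap l).
  rewrite !energy_crossing //; last exact: zigzag_sym.
  rewrite -mulrBr -sumrB; congr (_ * _); apply: eq_bigr => k _.
  by rewrite -sumrB; apply: eq_bigr => l _; rewrite -mulrBl.
have term_ge0 (k l : 'I_m) : 0 <= excess k l * (gap k * gap l).
  by rewrite !mulr_ge0.
split.
  by rewrite -subr_ge0 diff mulr_ge0 // sumr_ge0 // => k _; rewrite sumr_ge0.
move/eqP; rewrite -subr_eq0 diff mulf_eq0 pnatr_eq0 /= => /eqP/psumr_eq0P zero.
move=> k l klm zk zl; have [kl lm] := andP klm.
have km : (k < m)%N by exact: leq_ltn_trans lm.
have := zero (fun k _ => sumr_ge0 _ (fun l _ => term_ge0 k l)) (Ordinal km) isT.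
move/psumr_eq0P => /(_ (fun l _ => term_ge0 _ l) (Ordinal lm) isT) /= /eqP.
rewrite !mulf_eq0 !subr_eq0 ![z _.+1 == _]eq_sym (negbTE zk) (negbTE zl) !orbF.
rewrite eqr_nat (minn_idPl kl) (maxn_idPr kl) => /eqP->.
exact: zigzag_crossing.
Qed.

End EnergyExpansion.

(** * Ties in an eigenvector of the zigzag cycle *)

Section Ties.
Local Open Scope ring_scope.
Variables (R : realType) (m : nat) (z : nat -> R) (alpha : R).
Local Notation vertex := 'I_m.+1.
Hypothesis m_gt1 : (1 < m)%N.
Hypothesis z_mono : forall k, (k < m)%N -> z k <= z k.+1.
Hypothesis z_eigen : forall i : vertex,
  \sum_(j < m.+1) (zigzag i j)%:R * (z i - z j) = alpha * z i.

Definition tie (k : nat) : bool := z k == z k.+1.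

(** The two neighbours of position i on the zigzag cycle, below and above it
    except at the ends of the order. *)
Let lo (i : nat) : nat := if (1 < i)%N then i.-2 else (1 - i)%N.
Let hi (i : nat) : nat := if (i.+1 < m)%N then i.+2 else (m + m.-1 - i)%N.

Lemma sum_zigzag (i : vertex) (F : nat -> R) :
  \sum_(j < m.+1) (zigzag i j)%:R * F j = F (lo i) + F (hi i).
Proof.
have im := ltn_ord i.
have loK : (inord (lo i) : vertex) = lo i :> nat.
  by rewrite inordK // /lo; case: ifP; lia.
have hiK : (inord (hi i) : vertex) = hi i :> nat.
  by rewrite inordK // /hi; case: ifP; lia.
rewrite (bigD1 (inord (lo i) : vertex)) //=.
rewrite (bigD1 (inord (hi i) : vertex)) /=; last first.
  by rewrite -val_eqE /= loK hiK /lo /hi; do 2!case: ifP; lia.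
rewrite big1 ?addr0; last first.
  move=> j; rewrite -!val_eqE /= loK hiK => jlohi.
  suff -> : zigzag i j = false by rewrite mul0r.
  by have := ltn_ord j; move: jlohi; rewrite /zigzag /= /lo /hi;
    do 2!case: ifP; lia.
have -> : zigzag i (inord (lo i)) by rewrite /zigzag /= loK /lo; case: ifP; lia.
have -> : zigzag i (inord (hi i)) by rewrite /zigzag /= hiK /hi; case: ifP; lia.
by rewrite !mul1r loK hiK.
Qed.

Lemma z_le i j : (i <= j <= m)%N -> z i <= z j.
Proof.
case/andP; elim: j => [|j IHj]; first by rewrite leqn0 => /eqP->.
rewrite leq_eqVlt => /orP[/eqP-> //|ij] jm.
exact: le_trans (IHj ij (ltnW jm)) (z_mono jm).
Qed.

(** The difference of the eigenvalue equations at k and k + 1 equates z (lo k)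
    + z (hi k) with z (lo k.+1) + z (hi k.+1); by monotonicity each summand is
    at most the corresponding one. *)
Lemma tie_balance k : (k < m)%N -> tie k ->
  z (lo k) = z (lo k.+1) /\ z (hi k) = z (hi k.+1).
Proof.
move=> km /eqP zk.
have balance i : (i <= m)%N -> 2 * z i - z (lo i) - z (hi i) = alpha * z i.
  move=> im; have := z_eigen (@Ordinal m.+1 i im).
  by rewrite (sum_zigzag _ (fun j => z i - z j)) /= => <-; ring.
have := balance _ (ltnW km); have := balance _ km; rewrite -zk => E1 E0.
have le_lo : z (lo k) <= z (lo k.+1).
  have [k0|k0] := posnP k.
    by rewrite k0 (_ : lo 0 = 1%N) // (_ : lo 1 = 0%N) // -k0 zk k0.
  by apply: z_le; rewrite /lo; do 2!case: ifP; lia.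
have le_hi : z (hi k) <= z (hi k.+1).
  have [kE|k_neq] := eqVneq k.+1 m.
    have -> : hi k = k.+1 by rewrite /hi; case: ifP; lia.
    have -> : hi k.+1 = k by rewrite /hi; case: ifP; lia.
    by rewrite zk.
  by apply: z_le; rewrite /hi; do 2!case: ifP; lia.
by split; lra.
Qed.

Lemma tie_step k : (k.+2 < m)%N -> tie k = tie k.+2.
Proof.
move=> km; apply/idP/idP => tk.
  have [_] := tie_balance (ltnW (ltnW km)) tk; rewrite /hi (ltnW km) km => E.
  exact/eqP.
by have [] := tie_balance km tk; rewrite /lo /= => E _; apply/eqP.
Qed.

Lemma tie_same_parity k l :
  (k < m)%N -> (l < m)%N -> odd k = odd l -> tie k = tie l.
Proof.
wlog kl : k l / (k <= l)%N => [wl|].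
  by have [kl|/ltnW lk] := leqP k l; [exact: wl | move=> ? ? ?; apply/esym/wl].
move=> _ lm kl_odd; have -> : l = (k + (l - k)./2.*2)%N by lia.
have : (k + (l - k)./2.*2 < m)%N by lia.
elim: (l - k)./2 => [|j IHj]; first by rewrite addn0.
rewrite doubleS !addnS => lt_m; rewrite IHj; last by lia.
exact: tie_step.
Qed.

Hypothesis z_sum0 : \sum_(i < m.+1) z i = 0.
Hypothesis z_neq0 : exists i : vertex, z i != 0.

(** Ties of both parities would make all gaps ties, so z would be constant,
    hence zero because its sum vanishes. *)
Lemma tie_parity_unique k l :
  (k < m)%N -> (l < m)%N -> tie k -> tie l -> odd k = odd l.
Proof.
move=> km lm tk tl; apply/eqP; apply: contraT => kl_odd.
have ties j : (j < m)%N -> tie j.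
  move=> jm; have [jk|jk] := eqVneq (odd j) (odd k).
    by rewrite (tie_same_parity jm km jk).
  by rewrite (tie_same_parity jm lm) //; move: jk kl_odd; do 3!case: odd.
have z_const j : (j <= m)%N -> z j = z 0%N.
  by elim: j => // j IHj jm; rewrite -(IHj (ltnW jm)); apply/esym/eqP/ties.
case: z_neq0 => i; rewrite z_const -1?ltnS //.
have := z_sum0; under eq_bigr => j _ do rewrite z_const -1?ltnS //.
rewrite sumr_const card_ord => /eqP; rewrite mulrn_eq0 /= => ->.
by [].
Qed.

End Ties.

(** * Graphs with the fewest crossings at untied gaps *)

Section TightGraphs.
Variables (m : nat) (tie : pred nat).
Local Notation vertex := 'I_m.+1.
Hypothesis m_gt1 : 1 < m.
Hypothesis tie_parity :
  forall k l, k < m -> l < m -> odd k = odd l -> tie k = tie l.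
Hypothesis tie_one_parity :
  forall k l, k < m -> l < m -> tie k -> tie l -> odd k = odd l.

(** What equality of energies leaves of G: between untied gaps there are no
    more crossing edges than in the zigzag cycle. This form is invariant under
    exchanging the two vertices of a tied pair. *)
Record tight (g : rel vertex) : Prop := Tight {
  tight_sym : symmetric g;
  tight_cut : cut_connected g;
  tight_crossing : forall k l, k <= l < m -> ~~ tie k -> ~~ tie l ->
    #|crossing g k l| <= if k == l then 2 else (l == k.+1) }.

Definition relabel (g : rel vertex) (s : {perm vertex}) : rel vertex :=
  [rel i j | g (s i) (s j)].

Lemma relabelM g s t : relabel g (s * t)%g =2 relabel (relabel g t) s.
Proof. by move=> i j; rewrite /relabel /= !permM. Qed.

Lemma eq_tight g h : g =2 h -> tight g -> tight h.
Proof.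
move=> gh [sg cg xg]; split=> [i j|v S s t Ss St sv tv|k l kl tk tl].
- by rewrite -!gh.
- by have [a [b [? ? ? ? ab]]] := cg v S s t Ss St sv tv; exists a, b;
  rewrite -gh.
suff <- : crossing g k l = crossing h k l by exact: xg.
by apply/setP => e; rewrite !inE gh.
Qed.

(** Exchanging the two vertices of a tied pair preserves the initial segments
    that end at an untied gap, and only those enter the crossing bounds. *)
Lemma relabel_tight g (a b : vertex) : b = a.+1 :> nat -> tie a -> tight g ->
  tight (relabel g (tperm a b)).
Proof.
move=> ab ta [sg cg xg].
split=> [i j|v S s t Ss St sv tv|k l klm tk tl]; rewrite /relabel /=.
- exact: sg.
- pose p := tperm a b.
  have [||||i [j [Si Sj iv jv ij]]] := cg (p v) (preim p S) (p s) (p t).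
  + by rewrite /= /p tpermK.
  + by rewrite /= /p tpermK.
  + by rewrite (inj_eq perm_inj).
  + by rewrite (inj_eq perm_inj).
  exists (p i), (p j); rewrite /p !tpermK; split=> //.
    by apply: contraNneq iv => <-; rewrite /p tpermK.
  by apply: contraNneq jv => <-; rewrite /p tpermK.
pose p2 (e : vertex * vertex) := (tperm a b e.1, tperm a b e.2).
have p2_inj : injective p2 by move=> [i j] [i' j'] [/perm_inj-> /perm_inj->].
have keep k' (i : vertex) : ~~ tie k' -> (tperm a b i <= k') = (i <= k').
  move=> tk'; have ak : a != k' :> nat by apply: contraNneq tk' => <-.
  by case: tpermP => [->|->|//]; lia.
suff -> : crossing (fun i j : vertex => g (tperm a b i) (tperm a b j)) k l =
    p2 @^-1: crossing g k l by rewrite card_preimset //; apply: xg.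
by apply/setP => -[i j]; rewrite !inE /= keep // ![l < _]ltnNge keep.
Qed.

Lemma tight_no_jump g k l (i j : vertex) : tight g -> k.+2 <= l < m ->
  ~~ tie k -> ~~ tie l -> i <= k -> l < j -> g i j = false.
Proof.
move=> tg /andP[kl lm] tk tl ik lj; apply/negP => gij.
have : (i, j) \in crossing g k l by rewrite inE /= gij ik lj.
have klm : k <= l < m by rewrite lm ltnW // ltnW.
have := tight_crossing tg klm tk tl.
rewrite (ltn_eqF (ltnW kl)) (gtn_eqF kl) leqn0 cards_eq0 => /eqP->.
by rewrite inE.
Qed.

Lemma tight_two_crossings g k (e1 e2 e3 : vertex * vertex) : tight g -> k < m ->
  ~~ tie k -> e1 \in crossing g k k -> e2 \in crossing g k k ->
  e3 \in crossing g k k -> e1 != e2 -> e2 != e3 -> e3 != e1 -> False.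
Proof.
move=> tg km tk c1 c2 c3 n12 n23 n31.
have := tight_crossing tg (k := k) (l := k);
  rewrite eqxx leqnn km => /(_ isT tk tk).
by rewrite leqNgt => /negP[]; apply/card_gt2P; exists e1, e2, e3.
Qed.

Lemma eq_inord (c : vertex) i : c = i :> nat -> inord i = c.
Proof. by move=> <-; rewrite inord_val. Qed.

Arguments eq_inord : clear implicits.

Lemma tie_gap k : k.+1 < m -> tie k -> tie k.+1 = false.
Proof.
move=> km tk; apply/negP => tk1; have := tie_one_parity (ltnW km) km tk tk1.
by rewrite /=; case: odd.
Qed.

Lemma tie_add2 k : k.+2 < m -> tie k.+2 = tie k.
Proof. by move=> km; apply: tie_parity; rewrite /= ?negbK // ltnW // ltnW. Qed.

(** Some edge joins {0, ..., k} to {k+2, ..., m}, as deleting k + 1 does not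
    disconnect G. The crossing bounds exclude long edges, so it starts at k, or
    at k - 1 if these two are tied, and it ends at k + 2, or at k + 3 if those
    two are tied. It cannot start at k - 1: both edges across the gap k would
    leave from there, and deleting k - 1 would disconnect G. *)
Lemma straighten_step g k : tight g -> k.+2 <= m ->
  (forall i, i < k -> g (inord i) (inord i.+2)) ->
  g (inord k) (inord k.+2) \/
  [/\ g (inord k) (inord k.+3), k.+3 <= m & tie k.+2].
Proof.
move=> tg km steps.
have [||a [b [ak kb av bv ab]]] :=
  initial_cut (tight_cut tg) (v := inord k.+1) (k := k).
- by exists (inord k); rewrite -?val_eqE /= !inordK; lia.
- by exists (inord k.+2); rewrite -?val_eqE /= !inordK; lia.
have {bv}k2b : k.+2 <= b by move: bv; rewrite -val_eqE /= inordK; lia.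
have bm := ltn_ord b.
have [tie1|ntie1] := boolP (tie k.+1).
  have ntk : ~~ tie k by apply/negP => /(tie_gap (k := k)); rewrite tie1; lia.
  have bE : b = k.+2 :> nat.
    apply/eqP; rewrite eqn_leq k2b andbT leqNgt; apply/negP => kb2.
    have : g a b = false.
      apply: (tight_no_jump (k := k) (l := k.+2)) => //;
        rewrite ?tie_add2 //; lia.
    by rewrite ab.
  left; rewrite (eq_inord b k.+2) //.
  have [ka|ak'] := leqP k a.
    by rewrite (eq_inord a k) //; apply/eqP; rewrite eqn_leq ak.
  have aE : a = k.-1 :> nat.
    have [//|ak2] : a = k.-1 :> nat \/ a < k.-1 by lia.
    have tkm2 : tie k.-2 = tie k.
      by case: (k) km ak2 => [|[|j]] //= j2 _; rewrite tie_add2 // ltnW.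
    have : g a b = false.
      apply: (tight_no_jump (k := k.-2) (l := k)) => //;
        rewrite ?tkm2 //; lia.
    by rewrite ab.
  have ac : g a (inord k.+1).
    have := steps k.-1; rewrite (eq_inord a k.-1) // (_ : k.-1.+2 = k.+1);
      last by lia.
    by apply; lia.
  have [||a' [b' [ak2 kb2 av' _ ab']]] :=
    initial_cut (tight_cut tg) (v := a) (k := k).
  - by exists (inord k); rewrite -?val_eqE /= ?inordK; lia.
  - by exists (inord k.+1); rewrite -?val_eqE /= ?inordK; lia.
  have km' : k < m by lia.
  exfalso; apply: (tight_two_crossings (e1 := (a, inord k.+1)) (e2 := (a, b))
    (e3 := (a', b')) tg km' ntk); rewrite ?inE /= ?ac ?ab ?ab' ?ak ?kb ?ak2
      ?kb2 //=.
  - by rewrite inordK; lia.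
  - by rewrite xpair_eqE eqxx -val_eqE /= inordK; lia.
  - by rewrite xpair_eqE eq_sym (negbTE av').
  - by rewrite xpair_eqE (negbTE av').
have aE : a = k :> nat.
  apply/eqP; rewrite eqn_leq ak leqNgt; apply/negP => ak'.
  have : g a b = false.
    case: (k) km ntie1 ak' kb k2b => // j jm ntj aj jb j2b.
    by apply: (tight_no_jump (k := j) (l := j.+2)) => //;
      rewrite -?(tie_add2 (k := j)) //; lia.
  by rewrite ab.
rewrite (eq_inord a k) //.
have [bE|b_neq] := eqVneq (b : nat) k.+2; first by left;
  rewrite (eq_inord b k.+2).
have tk : tie k.
  apply: contraTT ab => ntk.
  by rewrite (tight_no_jump (k := k) (l := k.+2)) // ?tie_add2 //; lia.
right; rewrite tie_add2; last by lia.
have [bE|b_neq3] := eqVneq (b : nat) k.+3; first by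
  rewrite (eq_inord b k.+3) //; split=> //; lia.
have : g a b = false.
  apply: (tight_no_jump (k := k.+1) (l := k.+3)) => //;
    rewrite ?tie_add2 //; lia.
by rewrite ab.
Qed.

(** Whenever the step ends at k + 3 instead of k + 2, exchange these two tied
    positions; this leaves the edges found before untouched. *)
Lemma straighten g k : tight g -> k < m ->
  exists2 s : {perm vertex}, tight (relabel g s) &
    forall i, i < k -> relabel g s (inord i) (inord i.+2).
Proof.
move=> tg; elim: k => [|k IHk] km.
  by exists 1%g => //; apply: eq_tight tg => i j; rewrite /relabel /= !perm1.
have [s ts steps] := IHk (ltnW km).
have [stepk|[stepk k3m tk2]] := straighten_step ts km steps.
  by exists s => // i; rewrite ltnS leq_eqVlt => /orP[/eqP->|/steps].
have k2K : (inord k.+2 : vertex) = k.+2 :> nat by rewrite inordK //; lia.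
have k3K : (inord k.+3 : vertex) = k.+3 :> nat by rewrite inordK.
set t := tperm (inord k.+2 : vertex) (inord k.+3).
exists (t * s)%g.
  apply: (eq_tight (g := relabel (relabel g s) t)) => [i j|].
    by rewrite relabelM.
  by apply: relabel_tight => //; rewrite ?k2K ?k3K.
move=> i ik; rewrite relabelM /relabel /=.
have fixed j : j < k.+2 -> t (inord j) = inord j.
  move=> j_lt; have jK : (inord j : vertex) = j :> nat by rewrite inordK //;
    lia.
  by rewrite /t tpermD // -val_eqE /= ?k2K ?k3K jK; lia.
rewrite fixed; last by lia.
move: ik; rewrite ltnS leq_eqVlt => /orP[/eqP->|ik]; first by rewrite /t tpermL.
by rewrite fixed ?ltnS //; apply: steps.
Qed.

(** An untied gap, unless it is the first or the last, is already crossed by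
    two edges i, i + 2, so nothing else crosses it. *)
Lemma straight_edges g : tight g ->
  (forall i, i < m.-1 -> g (inord i) (inord i.+2)) ->
  forall i j : vertex, i < j -> g i j ->
    [\/ j = i.+2 :> nat, j = i.+1 :> nat /\ (i = 0 :> nat \/ j = m :> nat)
      | j = i.+1 :> nat /\ tie i].
Proof.
move=> tg steps i j ij gij.
have jm := ltn_ord j.
have [jE|j_neq] := eqVneq (j : nat) i.+2; first by constructor 1.
have [jE|j_neq1] := eqVneq (j : nat) i.+1; last first.
  exfalso; have tieE : tie i.+2 = tie i by apply: tie_add2; lia.
  have ti : tie i.
    apply: contraTT gij => nti.
    by rewrite (tight_no_jump (k := i) (l := i.+2)) // ?tieE //; lia.
  have nt1 : ~~ tie i.+1 by rewrite tie_gap //; lia.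
  have := steps i; have := steps i.+1; rewrite (eq_inord i i) // => s1 s0.
  apply: (tight_two_crossings (e1 := (i, j)) (e2 := (i, inord i.+2))
    (e3 := (inord i.+1, inord i.+3)) tg _ nt1);
    rewrite ?inE /= ?gij ?s0 ?s1 -?val_eqE ?xpair_eqE -?val_eqE /= ?inordK;
    lia.
have [ti|nti] := boolP (tie i); first by constructor 3.
constructor 2; split=> //.
have [->|i0] := eqVneq (i : nat) 0; first by left.
have [->|jm'] := eqVneq (j : nat) m; first by right.
exfalso; have := steps i; have := steps i.-1;
  rewrite (eq_inord i i) // => s1 s0.
rewrite (_ : i.-1.+2 = j) in s1; last by lia.
apply: (tight_two_crossings (e1 := (i, j)) (e2 := (i, inord i.+2))
    (e3 := (inord i.-1, j)) tg _ nti);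
  rewrite ?inE /= ?gij ?s0 -?val_eqE ?xpair_eqE -?val_eqE /= ?inordK; try lia.
by rewrite inord_val in s1; rewrite s1; lia.
Qed.

(** The edges {0, 1} and {m-1, m} are still missing; each of them is the only
    possible second edge at an end of the order. *)
Lemma straight_zigzag g : tight g ->
  (forall i, i < m.-1 -> g (inord i) (inord i.+2)) ->
  forall i j : vertex, zigzag i j -> g i j.
Proof.
move=> tg steps i j; wlog ij : i j / i < j => [wl|].
  have [|ji|ij] := ltngtP i j; first exact: wl.
    by rewrite zigzag_sym (tight_sym tg); apply: wl.
  by rewrite /zigzag /=; lia.
have straight := straight_edges tg steps.
have im := ltn_ord i; have jm := ltn_ord j; rewrite /zigzag /= => zij.
have [jE|j_neq] := eqVneq (j : nat) i.+2.
  by rewrite -(eq_inord i i) // -(eq_inord j i.+2) //; apply: steps; lia.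
have [i0|i_neq0] := eqVneq (i : nat) 0.
  have [||a [b [ai ib _ b2 ab]]] :=
    initial_cut (tight_cut tg) (v := inord 2) (k := 0).
  - by exists i; rewrite -?val_eqE /= ?inordK; lia.
  - by exists j; rewrite -?val_eqE /= ?inordK; lia.
  have b2' : b != 2 :> nat by move: b2; rewrite -val_eqE /= inordK.
  have aE : a = i by apply: val_inj; move: ai; rewrite /=; lia.
  have bE : b = j.
    by apply: val_inj => /=; have := straight a b; rewrite ab; case=> //; lia.
  by rewrite -aE -bE.
have [||a [b [ai ib am _ ab]]] :=
  initial_cut (tight_cut tg) (v := inord m.-2) (k := m.-1).
- by exists i; rewrite -?val_eqE /= ?inordK; lia.
- by exists j; rewrite -?val_eqE /= ?inordK; lia.
have bm := ltn_ord b; have am' : a != m.-2 :> nat.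
  by move: am; rewrite -val_eqE /= inordK //; lia.
have bE : b = j by apply: val_inj => /=; lia.
have aE : a = i.
  by apply: val_inj => /=; have := straight a b; rewrite ab; case=> //; lia.
by rewrite -aE -bE.
Qed.

End TightGraphs.

(** * Unfolding the zigzag cycle *)

Section CyclePositions.
Variables (m : nat) (p : bool).
Local Notation vertex := 'I_m.+1.

(** Odd positions go up one side of C_n and even positions down the other. With
    p = true the labels are rotated by one, so that position 0 becomes v_0 and
    the pair 2k - 1, 2k becomes v_k, v_(n-k); with p = false the pair 2k, 2k +
    1 becomes v_(n-1-k), v_k. *)
Definition cycle_pos (i : nat) : nat :=
  if odd i then i./2 + p else if (i == 0) && p then 0 else m - i./2 + p.

Lemma cycle_pos_lt (i : vertex) : cycle_pos i < m.+1.
Proof.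
by have := ltn_ord i; rewrite /cycle_pos; do !case: ifP; case: (p) => /=; lia.
Qed.

Definition to_cycle (i : vertex) : vertex := Ordinal (cycle_pos_lt i).

Lemma to_cycle_bij : bijective to_cycle.
Proof.
apply: injF_bij => i j /(congr1 val) /=; rewrite /cycle_pos => E;
  apply: val_inj => /=.
have := ltn_ord i; have := ltn_ord j; move: E; do !case: ifP; case: (p) => /=;
  lia.
Qed.

Lemma to_cycle_zigzag i j : 1 < m ->
  cycle_rel (to_cycle i) (to_cycle j) = zigzag i j.
Proof.
move=> m_gt1; have modS (x : nat) :
    x < m.+1 -> x.+1 %% m.+1 = if x == m then 0 else x.+1.
  by case: eqVneq => [->|xm] ?; rewrite ?modnn // modn_small //; lia.
rewrite /cycle_rel /zigzag /= -val_eqE /= !modS ?cycle_pos_lt //.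
have := ltn_ord i; have := ltn_ord j; rewrite /cycle_pos; do !case: ifP;
  case: (p) => /=; lia.
Qed.

End CyclePositions.

Lemma foldl_add_edge n (b : nat -> nat) (s : seq nat) (H : sgraph 'I_n) x y :
  foldl (fun H i => add_edge H i (b i)) H s x y =
  H x y || (x != y) &&
    has (fun i => (x == i :> nat) && (y == b i :> nat) ||
                  (x == b i :> nat) && (y == i :> nat)) s.
Proof.
elim: s H => [|i s IHs] H /=; first by rewrite andbF orbF.
by rewrite IHs /= andb_orr orbA.
Qed.

Section RungGraphs.
Variables (m : nat) (p : bool) (T : finType) (G : sgraph T) (e : 'I_m.+1 -> T).
Hypothesis m_gt1 : 1 < m.
Hypothesis bij_e : bijective e.
Hypothesis zigzag_G : forall i j, zigzag i j -> G (e i) (e j).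
Hypothesis G_rungs : forall i j : 'I_m.+1, i < j -> G (e i) (e j) ->
  zigzag i j \/ j = i.+1 :> nat /\ odd i = p.

(** The index k stands for the pair of positions 2k - p, 2k - p + 1. The bound
    (m - 2 + p)./2 is the largest k for which this pair does not form an edge
    of the zigzag cycle; it equals the bound in the definition of the
    corresponding family of graphs. *)
Definition rungs : seq nat :=
  [seq k <- iota 1 (m - 2 + p)./2 |
     G (e (inord (k.*2 - p))) (e (inord (k.*2 - p).+1))].

Lemma rungs_admissible M : M = (m - 2 + p)./2 -> rungs <> [::] ->
  admissible M rungs.
Proof.
move=> -> rungs0; apply/and3P; split.
- rewrite lt0n size_eq0; apply/andP; split; first exact/eqP.
  by rewrite size_filter (leq_trans (count_size _ _)) ?size_iota.
- by apply: sorted_filter; [exact: leq_trans | exact: iota_sorted].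
by apply/allP => k; rewrite mem_filter mem_iota => /andP[_]; lia.
Qed.

(** The equation on b covers both v_k v_(n-k), for p = true, and v_k v_(n-1-k),
    for p = false. *)
Lemma isomorphic_rungs (b : nat -> nat) : (forall k, b k = p + m - k) ->
  isomorphic G (foldl (fun H k => add_edge H k (b k)) (cycle_graph m.+1) rungs).
Proof.
move=> bE; have [e' eK e'K] := bij_e; have [t' tK t'K] := @to_cycle_bij m p.
exists (to_cycle p \o e').
  by apply: bij_comp; [exact: to_cycle_bij | exists e].
move=> x y /=; rewrite -{2}[x]e'K -{2}[y]e'K; move: (e' x) (e' y) => {x y} i j.
rewrite foldl_add_edge /= to_cycle_zigzag // (inj_eq (can_inj tK)).
have tval (k : 'I_m.+1) : to_cycle p k = cycle_pos m p k :> nat by [].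
apply/idP/idP.
  case/orP => [/zigzag_G//|/andP[ij /hasP[k]]].
  rewrite mem_filter mem_iota bE => /andP[Gk k_range].
  set u : 'I_m.+1 := inord (k.*2 - p) in Gk.
  set w : 'I_m.+1 := inord _.+1 in Gk.
  have uK : u = (k.*2 - p)%N :> nat.
    by rewrite inordK //; move: k_range; case: (p); lia.
  have wK : w = (k.*2 - p).+1 :> nat.
    by rewrite inordK //; move: k_range; case: (p); lia.
  have uw : (to_cycle p u == k :> nat) && (to_cycle p w == p + m - k :> nat) ||
            (to_cycle p u == p + m - k :> nat) && (to_cycle p w == k :> nat).
    rewrite !tval uK wK /cycle_pos; move: k_range {Gk uK wK}.
    by case: (p) => /=; do !(case: ifP => /=); lia.
  have inj (a c : 'I_m.+1) : to_cycle p a = to_cycle p c :> nat -> a = c.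
    by move=> tc; apply: (can_inj tK); exact: val_inj.
  case/orP: uw => /andP[/eqP tu /eqP tw] /orP[] /andP[/eqP ti /eqP tj].
  - by rewrite (inj i u (etrans ti (esym tu))) (inj j w (etrans tj (esym tw))).
  - rewrite (inj i w (etrans ti (esym tw))) (inj j u (etrans tj (esym tu))).
    by rewrite edge_sym.
  - rewrite (inj i w (etrans ti (esym tw))) (inj j u (etrans tj (esym tu))).
    by rewrite edge_sym.
  - by rewrite (inj i u (etrans ti (esym tu))) (inj j w (etrans tj (esym tw))).
wlog ij : i j / i < j => [wl Gij|Gij].
  have [ij|ji|/val_inj ij] := ltngtP i j; first exact: wl.
    rewrite zigzag_sym eq_sym; have := wl j i ji; rewrite edge_sym => /(_ Gij).
    by under eq_has => k do rewrite orbC andbC [X in _ || X]andbC.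
  by rewrite ij edge_irrefl in Gij.
have [-> //|[jE oi]] := G_rungs ij Gij.
have [//|nz] := boolP (zigzag i j).
rewrite neq_ltn ij /=; apply/hasP.
have im := ltn_ord i; have jm := ltn_ord j.
have kE : ((i + p)./2.*2 - p)%N = i by move: oi; case: (p); lia.
exists (i + p)./2.
  rewrite mem_filter kE -jE !inord_val Gij mem_iota /=.
  by move: nz oi; rewrite /zigzag /= jE; case: (p); lia.
rewrite bE /cycle_pos jE; move: nz oi; rewrite /zigzag /= jE.
by case: (p) => /=; do !(case: ifP => /=); lia.
Qed.

End RungGraphs.

(** * Comparison of G with the cycle *)

Section Sorting.
Local Open Scope ring_scope.

Lemma sorted_enumeration (R : realType) (T : finType) m (x : T -> R) :
  #|T| = m.+1 ->
  exists2 e : 'I_m.+1 -> T, bijective e &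
    forall i j : 'I_m.+1, (i <= j)%N -> x (e i) <= x (e j).
Proof.
move=> cardT; pose le_x := relpre x (<=%R : rel R).
pose s := sort le_x (enum T).
have size_s : size s = m.+1 by rewrite size_sort -cardE.
have [x0 _] : exists x0 : T, true by apply/card_gt0P; rewrite cardT.
exists (fun i : 'I_m.+1 => nth x0 s i).
  apply: inj_card_bij; last by rewrite card_ord cardT.
  move=> i j /eqP; rewrite nth_uniq ?size_s ?ltn_ord ?sort_uniq ?enum_uniq //.
  by move/eqP/val_inj.
have srt : sorted le_x s by apply: sort_sorted => u v; exact: le_total.
move=> i j ij.
apply: (@sorted_leq_nth _ le_x _ _ x0 s srt) => //; rewrite ?inE ?size_s //.
  by move=> a c d; apply: le_trans.
by move=> a; apply: lexx.
Qed.

End Sorting.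

Section Comparison.
Local Open Scope ring_scope.
Variables (R : realType) (T : finType) (m : nat) (G : sgraph T).
Hypotheses (m_gt1 : (1 < m)%N) (cardT : #|T| = m.+1) (cut_G : cut_connected G).
Local Notation zvec z := (fun i : 'I_m.+1 => z (nat_of_ord i)).
Local Notation alphaG := (algebraic_connectivity R G).
Local Notation alphaC := (algebraic_connectivity R (cycle_graph m.+1)).
Local Notation vertex := 'I_m.+1.

(** z is indexed by natural numbers so that its values at consecutive positions
    can be compared without proofs that they are in range. *)
Lemma sorted_fiedler : exists (e : vertex -> T) (z : nat -> R),
  [/\ bijective e, forall k, (k < m)%N -> z k <= z k.+1,
      exists i : vertex, z i != 0, \sum_(i < m.+1) z i = 0 &
      energy (fun i j => G (e i) (e j)) (zvec z) =
        2 * alphaG * \sum_(i < m.+1) z i ^+ 2].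
Proof.
have T_gt1 : (1 < #|T|)%N by rewrite cardT ltnS (ltnW m_gt1).
have [x [[u xu] x0 Ex]] := fiedler_function R G T_gt1.
have [e bij_e e_mono] := sorted_enumeration x cardT.
have zE (i : vertex) : x (e (inord i)) = x (e i) by rewrite inord_val.
have [e' eK e'K] := bij_e.
exists e, (fun k => x (e (inord k))); split=> //.
- by move=> k km; apply: e_mono; rewrite !inordK // ltnS ltnW.
- by exists (e' u); rewrite zE e'K.
- rewrite -[RHS]x0 (reindex e) /=; last exact: onW_bij.
  by apply: eq_bigr => i _.
have -> : \sum_(i < m.+1) x (e (inord i)) ^+ 2 = \sum_u x u ^+ 2.
  rewrite [RHS](reindex e) /=; last exact: onW_bij.
  by apply: eq_bigr => i _; rewrite zE.
rewrite -Ex (energy_iso (g := fun i j => G (e i) (e j)) (f := e)) //.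
by rewrite /energy; apply: eq_bigr => i _; apply: eq_bigr => j _;
  rewrite /= !zE.
Qed.

(** The zigzag cycle is a copy of C_n, so it inherits the variational
    inequality and its equality case. *)
Lemma zigzag_energy (z : nat -> R) : \sum_(i < m.+1) z i = 0 ->
  2 * alphaC * (\sum_(i < m.+1) z i ^+ 2) <=
    energy (@zigzag m) (zvec z) /\
  (energy (@zigzag m) (zvec z) = 2 * alphaC * (\sum_(i < m.+1) z i ^+ 2) ->
   forall i : vertex,
     \sum_(j < m.+1) (zigzag i j)%:R * (z i - z j) = alphaC * z i).
Proof.
move=> z0; have bij_t := @to_cycle_bij m false; have [t' tK t'K] := bij_t.
pose y (v : vertex) := z (t' v).
have yE i : y (to_cycle false i) = z i by rewrite /y tK.
have sum_to_cycle (F : vertex -> R) : \sum_v F v = \sum_i F (to_cycle false i).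
  by rewrite (reindex (to_cycle false)) //; exact: onW_bij.
have sum_y : \sum_v y v = 0 by rewrite sum_to_cycle -[RHS]z0;
  apply: eq_bigr => i _.
have norm_y : \sum_v y v ^+ 2 = \sum_(i < m.+1) z i ^+ 2.
  by rewrite sum_to_cycle; apply: eq_bigr => i _; rewrite yE.
have energy_y : energy (cycle_graph m.+1) y = energy (@zigzag m) (zvec z).
  rewrite (energy_iso (h := cycle_graph m.+1) (g := @zigzag m)
    (f := to_cycle false)) //.
    by apply: eq_bigr => i _; apply: eq_bigr => j _; rewrite /= !yE.
  by move=> i j; exact: to_cycle_zigzag.
have n_gt1 : (1 < #|vertex|)%N by rewrite card_ord ltnS ltnW.
have [] := energy_ge_algebraic_connectivity (cycle_graph m.+1) n_gt1 sum_y.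
rewrite norm_y energy_y => le_y eq_y; split=> // E i.
have := eq_y E (to_cycle false i); rewrite yE => <-.
rewrite /laplacian_op [RHS]sum_to_cycle; apply: eq_bigr => j _.
by rewrite /= to_cycle_zigzag // !yE.
Qed.

Lemma relabel_cut_connected (e : vertex -> T) : bijective e ->
  cut_connected (fun i j => G (e i) (e j)).
Proof.
move=> bij_e v S s t Ss St sv tv; have [e' eK e'K] := bij_e.
have [||||a [b [Sa Sb av bv ab]]] :=
  cut_G (v := e v) (S := S \o e') (s := e s) (t := e t).
- by rewrite /= eK.
- by rewrite /= eK.
- by rewrite (bij_eq bij_e).
- by rewrite (bij_eq bij_e).
exists (e' a), (e' b); rewrite !e'K; split=> //.
  by apply: contraNneq av => <-; rewrite e'K.
by apply: contraNneq bv => <-; rewrite e'K.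
Qed.

Lemma sum_sqr_gt0 (z : nat -> R) : (exists i : vertex, z i != 0) ->
  0 < \sum_(i < m.+1) z i ^+ 2.
Proof.
case=> i zi; rewrite (bigD1 i) //= ltr_pwDl ?sumr_ge0 // => [|j _]; last first.
  exact: sqr_ge0.
by rewrite lt_neqAle sqr_ge0 eq_sym sqrf_eq0 zi.
Qed.

Lemma cycle_algebraic_connectivity_min : alphaC <= alphaG.
Proof.
have [e [z [bij_e z_mono z_neq0 z_sum0 Ez]]] := sorted_fiedler.
have sym_g : symmetric (fun i j => G (e i) (e j)).
  by move=> i j; exact: edge_sym.
have cut_g := relabel_cut_connected bij_e.
have [le_zz _] := energy_zigzag_le m_gt1 z_mono sym_g cut_g.
have [le_z _] := zigzag_energy z_sum0.
have := le_trans le_z le_zz; rewrite Ez ler_pM2r ?sum_sqr_gt0 // ler_pM2l //.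
Qed.

(** [p] tells whether the ties are at odd gaps; without ties G is the zigzag
    cycle itself. *)
Lemma extremal_structure : alphaG = alphaC ->
  exists (p : bool) (e : vertex -> T), [/\ bijective e,
    forall i j, zigzag i j -> G (e i) (e j) &
    forall i j : vertex, (i < j)%N -> G (e i) (e j) ->
      zigzag i j \/ j = i.+1 :> nat /\ odd i = p].
Proof.
move=> eq_alpha; have [e [z [bij_e z_mono z_neq0 z_sum0 Ez]]] := sorted_fiedler.
pose g : rel vertex := fun i j => G (e i) (e j).
have sym_g : symmetric g by move=> i j; exact: edge_sym.
have cut_g : cut_connected g := relabel_cut_connected bij_e.
have [le_zz eq_zz] := energy_zigzag_le m_gt1 z_mono sym_g cut_g.
have [le_z eq_z] := zigzag_energy z_sum0.
have E1 : energy (@zigzag m) (zvec z) =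
    2 * alphaC * (\sum_(i < m.+1) z i ^+ 2).
  by apply: le_anti; rewrite le_z andbT -eq_alpha -Ez.
have eigen := eq_z E1.
have parity := tie_same_parity m_gt1 z_mono eigen.
have unique := tie_parity_unique m_gt1 z_mono eigen z_sum0 z_neq0.
have tight_g : tight (tie z) g.
  split=> //.
  by apply: eq_zz; rewrite Ez E1 eq_alpha.
have m1 : (m.-1 < m)%N by lia.
have [s tight_s steps] := straighten m_gt1 parity unique tight_g m1.
pose p := [exists k : 'I_m, tie z k && odd k].
exists p, (e \o s); split.
- by apply: bij_comp => //; exact: injF_bij perm_inj.
- by move=> i j; exact: (straight_zigzag m_gt1 parity unique tight_s steps).
move=> i j ij gij; have jm := ltn_ord j.
have [jE|[jE ends]|[jE ti]] := straight_edges m_gt1 parity unique tight_s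
  steps ij gij.
- by left; rewrite /zigzag /= jE eqxx.
- by left; rewrite /zigzag /=; lia.
right; split=> //; have im : (i < m)%N by rewrite -jE -ltnS.
apply/idP/existsP => [oi|[k /andP[tk ok]]]; first by exists (Ordinal im);
  rewrite /= ti.
by rewrite (unique i k im).
Qed.

End Comparison.

Theorem theorem1p1 (R : realType) (T : finType) (n : nat) (G : sgraph T)
    (order_G : #|T| = n) (conn_G : two_connected G) :
  (algebraic_connectivity R (cycle_graph n) <= algebraic_connectivity R G)%R
  /\ (odd n ->
      algebraic_connectivity R G = algebraic_connectivity R (cycle_graph n) ->
      isomorphic G (cycle_graph n)
      \/ exists s : seq nat, H1_admissible n s /\ isomorphic G (H1 n s))
  /\ (~~ odd n ->
      algebraic_connectivity R G = algebraic_connectivity R (cycle_graph n) ->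
      isomorphic G (cycle_graph n)
      \/ (exists s : seq nat, H2_admissible n s /\ isomorphic G (H2 n s))
      \/ (exists s : seq nat, H3_admissible n s /\ isomorphic G (H3 n s))).
Proof.
have cut_G := two_connected_cut_connected conn_G.
have := two_connected_order conn_G; rewrite order_G.
case: n order_G => // m cardT; rewrite ltnS => m_gt1.
split; first exact: cycle_algebraic_connectivity_min.
have rung_count (s : seq nat) M : admissible M s -> (0 < M)%N.
  by case/and3P=> /andP[s_gt0 s_le] _ _; exact: leq_trans s_gt0 s_le.
split=> par_n /(extremal_structure m_gt1 cardT cut_G)[p [e [bij_e zz_e
  rung_e]]].
  have [e1 [bij_e1 zz_e1 rung_e1]] : exists e1 : 'I_m.+1 -> T, [/\ bijective e1,
      forall i j, zigzag i j -> G (e1 i) (e1 j) &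
      forall i j : 'I_m.+1, (i < j)%N -> G (e1 i) (e1 j) ->
        zigzag i j \/ j = i.+1 :> nat /\ odd i = true].
    case: p rung_e => rung_e; first by exists e.
    (* For even m reversing the order exchanges the parities of the gaps. *)
    have rev_zigzag i j : zigzag (rev_ord i) (rev_ord j) = @zigzag m i j.
      by have := ltn_ord i; have := ltn_ord j; rewrite /zigzag /=; lia.
    exists (e \o @rev_ord m.+1); split=> [|i j zij|i j ij gij].
    - by apply: bij_comp => //; exact: injF_bij rev_ord_inj.
    - by apply: zz_e; rewrite rev_zigzag.
    have im := ltn_ord i; have jm := ltn_ord j.
    have [||zji|[jE oj]] := rung_e (rev_ord j) (rev_ord i).
    - by rewrite /=; lia.
    - by rewrite edge_sym.
    - by left; rewrite zigzag_sym -rev_zigzag.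
    by right; move: jE oj; rewrite /=; lia.
  have iso := isomorphic_rungs (p := true) (b := subn m.+1) m_gt1 bij_e1 zz_e1
    rung_e1 (fun=> erefl).
  have [s0|/eqP s0] := eqVneq (rungs true G e1) [::].
    by left; rewrite s0 in iso.
  right; exists (rungs true G e1); split=> //.
  have adm : admissible ((m.+1 - 3) %/ 2) (rungs true G e1).
    by apply: rungs_admissible s0 => //; move: par_n => /=; lia.
  by rewrite /H1_admissible par_n adm andbT; have := rung_count _ _ adm; lia.
case: p rung_e => rung_e.
  have iso := isomorphic_rungs (p := true) (b := subn m.+1) m_gt1 bij_e zz_e
    rung_e (fun=> erefl).
  have [s0|/eqP s0] := eqVneq (rungs true G e) [::].
    by left; rewrite s0 in iso.
  right; left; exists (rungs true G e); split=> //.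
  have adm : admissible ((m.+1 - 2) %/ 2) (rungs true G e).
    by apply: rungs_admissible s0 => //; move: par_n => /=; lia.
  by rewrite /H2_admissible par_n adm andbT; have := rung_count _ _ adm; lia.
have bE k : (m.+1 - k - 1)%N = (false + m - k)%N by lia.
have iso := isomorphic_rungs (p := false) m_gt1 bij_e zz_e rung_e bE.
have [s0|/eqP s0] := eqVneq (rungs false G e) [::].
  by left; rewrite s0 in iso.
right; right; exists (rungs false G e); split=> //.
have adm : admissible ((m.+1 - 4) %/ 2) (rungs false G e).
  by apply: rungs_admissible s0 => //; move: par_n => /=; lia.
by rewrite /H3_admissible par_n adm andbT; have := rung_count _ _ adm; lia.
Qed.
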